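(* Let $F$ be an algebraically closed field, $n\ge 1$, and let $B\in M_n(F)$ be a nilpotent matrix. Then the subset $\pi_B(U_B)$ is dense in $\mathcal{N}_B$. So, for a generic matrix $A\in\mathcal{N}_B$, the unital subalgebra $\mathcal{A}=\mathcal{A}(A,B)$ of $M_n(F)$ generated by $A$ and $B$ is Gorenstein; moreover, it is a complete intersection. Equivalently, for a generic $A\in\mathcal{N}_B$, both $\mathcal{A}$ and $\mathcal{A}^T$ have a cyclic vector in $F^n$, i.e., the action of $\mathcal{A}$ on $F^n$ is cyclic and cocyclic.
   Context: $\mathcal{N}_B=\{A\in M_n(F): A \text{ nilpotent},\ AB=BA\}$ is the nilpotent commutator of $B$, which is known to be an irreducible variety (Zariski topology). A property holds for a generic $A\in\mathcal{N}_B$ if it holds for all $A$ in some nonempty (hence dense) Zariski open subset of $\mathcal{N}_B$. $\mathcal{A}(A,B)$ denotes the unital subalgebra of $M_n(F)$ generated by $A$ and $B$, and $\mathcal{A}^T=\mathcal{A}(A^T,B^T)$ the unital subalgebra generated by the transposes. For commuting nilpotent $A,B$, $\mathcal{A}(A,B)$ is a commutative local artinian algebra; such an algebra with maximal ideal $m$ is Gorenstein if its socle $\mathrm{Soc}(\mathcal{A})=(0:m)$ (the annihilator of $m$ in $\mathcal{A}$) is one-dimensional over $F$. A vector $v\in F^n$ is cyclic for a commuting pair $(A,B)$ (equivalently, for $\mathcal{A}(A,B)$) if $\mathcal{A}(A,B)v=F^n$; the action of $\mathcal{A}$ is cocyclic if $\mathcal{A}^T$ has a cyclic vector. The set $U_B\subset\mathcal{N}_B\times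 F^n\times F^n$ is the set of all triples $(A,v,w)$ such that $v$ is a cyclic vector for $(A,B)$ and $w$ is a cyclic vector for $(A^T,B^T)$. The map $\pi_B:\mathcal{N}_B\times F^n\times F^n\to\mathcal{N}_B$ is the projection to the first factor. *)

(* Defs.v *)
From HB Require Import structures.
From mathcomp Require Import all_boot all_order all_algebra all_field.
From mathcomp Require Import mpoly.

Set Implicit Arguments.
Unset Strict Implicit.
Unset Printing Implicit Defensive.
Import GRing.Theory.
Local Open Scope ring_scope.

Section Zariski.
Variables (F : fieldType) (m n : nat).
Implicit Types (X Y W P : 'M[F]_(m, n) -> Prop).

(* A polynomial in the m * n matrix entries, evaluated at A. *)
Definition entry_eval (p : {mpoly F[m * n]}) (A : 'M[F]_(m, n)) : F :=
  p.@[fun k => mxvec A 0 k].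

(* W is the set of points of X outside the zero locus of S. *)
Definition zariski_open_in X W : Prop :=
  exists S : {mpoly F[m * n]} -> Prop,
    forall A, W A <-> X A /\ exists2 p, S p & entry_eval p A != 0.

Definition zariski_dense_in X Y : Prop :=
  forall W, zariski_open_in X W -> (exists A, W A) -> exists A, W A /\ Y A.

Definition generic_in X P : Prop :=
  exists W, [/\ zariski_open_in X W, exists A, W A & forall A, W A -> P A].

End Zariski.

Section LocalAlgebras.
Variables (F : fieldType) (aT : falgType F).
Implicit Types (E : {aspace aT}) (I M : {vspace aT}).

Definition is_comm_alg E : Prop :=
  forall x y, x \in E -> y \in E -> x * y = y * x.

(* Two-sided ideals as soon as E is commutative. *)
Definition is_ideal E I : bool := (I <= E)%VS && (E * I <= I)%VS.

Definition is_maximal_ideal E M : Prop :=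
  [/\ is_ideal E M, M != E &
      forall I, is_ideal E I -> (M <= I)%VS -> I = M \/ I = E].

Definition is_local_alg E M : Prop :=
  [/\ is_comm_alg E, is_maximal_ideal E M &
      forall M', is_maximal_ideal E M' -> M' = M].

Definition socle E M : {vspace aT} :=
  (E :&: \bigcap_(i < \dim M) lker (amulr (vbasis M)`_i))%VS.

Lemma socleP E M x :
  reflect (x \in E /\ forall y, y \in M -> x * y = 0) (x \in socle E M).
Proof.
rewrite memv_cap; apply: (iffP andP) => -[Ex x0]; split=> //.
  move=> y My; rewrite (coord_vbasis My) mulr_sumr big1 // => i _.
  rewrite -scalerAr; move/subv_bigcapP: x0 => /(_ i isT).
  by rewrite -memvE memv_ker lfunE /= => /eqP->; rewrite scaler0.
apply/subv_bigcapP => i _; rewrite -memvE memv_ker lfunE /= x0 //.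
by apply: vbasis_mem; rewrite mem_nth // size_tuple.
Qed.

Definition gorenstein E : Prop :=
  exists2 M, is_local_alg E M & \dim (socle E M) = 1%N.

(* p lies in the contraction to F[X_1..X_r] of the ideal generated by
   f_1, .., f_s in the localization of F[X_1..X_r] at (X_1, .., X_r). *)
Definition in_local_ideal r s (f : 'I_s -> {mpoly F[r]}) (p : {mpoly F[r]}) :
    Prop :=
  exists2 u : {mpoly F[r]}, u.@[fun=> 0] != 0 &
    exists c : 'I_s -> {mpoly F[r]}, u * p = \sum_(j < s) c j * f j.

(* E is isomorphic to R / (f_1, .., f_r), where R is F[X_1..X_r] localized at
   the origin: a regular local ring of dimension r.  The quotient E being
   artinian, the r elements f_j are a regular sequence in R.  Polynomials with
   nonzero constant term are already units of F[X_1..X_r] / ker phi (they are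
   nonzerodivisors of a finite-dimensional algebra), so that the localization
   is entirely described by the kernel of phi; and every local artinian algebra
   with residue field F that is a quotient of R is the image of such a phi. *)
Definition complete_intersection E : Prop :=
  exists (r : nat) (f : 'I_r -> {mpoly F[r]})
         (phi : {lrmorphism {mpoly F[r]} -> aT}),
    (forall x, x \in E <-> exists p, phi p = x) /\
    (forall p, phi p = 0 <-> in_local_ideal f p).

End LocalAlgebras.

(* The size n.+1 encodes n >= 1; F^n is the space of column vectors. *)
Section CommutingPairs.
Variables (F : fieldType) (n : nat).
Implicit Types (A B : 'M[F]_n.+1) (v w : 'cV[F]_n.+1).

Definition nilpotent_mx A : Prop := exists k : nat, A ^+ k = 0.

Definition nilp_commutator B A : Prop := nilpotent_mx A /\ A * B = B * A.

Definition gen_alg A B : {aspace 'M[F]_n.+1} := <<1 & [:: A; B]>>%AS.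

Definition cyclic_vector (E : {aspace 'M[F]_n.+1}) v : Prop :=
  forall u : 'cV[F]_n.+1, exists2 X : 'M[F]_n.+1, X \in E & X *m v = u.

Definition has_cyclic_vector E : Prop := exists v, cyclic_vector E v.

Definition cyclic_triples B A v w : Prop :=
  [/\ nilp_commutator B A, cyclic_vector (gen_alg A B) v
    & cyclic_vector (gen_alg A^T B^T) w].

Definition proj_cyclic_triples B A : Prop :=
  exists v w, cyclic_triples B A v w.

End CommutingPairs.

(* Main.v *)
Require Import Defs.
From HB Require Import structures.
From mathcomp Require Import all_boot all_order all_algebra all_field.
From mathcomp Require Import mpoly ring.

Set Implicit Arguments.
Unset Strict Implicit.
Unset Printing Implicit Defensive.
Import GRing.Theory.
Local Open Scope ring_scope.

(** Row vectors are used throughout: F^n is a module over F[X0, X1] through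
v |-> v *m pair_eval A B p, and transposing a pair exchanges cyclicity of its
rows with cyclicity of its columns.

Genericity.  By Nakayama, for commuting nilpotent A and B the row module is
cyclic as soon as F^n = F e + F^n A + F^n B for some e ([monogenic_cyclic]),
which amounts to the non-vanishing of one of a family of determinants that are
polynomial in the entries of A.  Call A bimonogenic when both (A, B) and (A^T,
B^T) have this property; this is a Zariski open condition on the nilpotent
commutator of B.  The irreducibility of the nilpotent commutator is replaced
by an explicit deformation ([cyclic_deformation]): for every A in it there is
a C commuting with B such that (C, B) is monogenic and all the combinations of
A and C are nilpotent.  The line through A and C then lies in the nilpotent
commutator, and as F is infinite two polynomials, one nonzero at A and the
other nonzero at C, are both nonzero somewhere on that line.  So monogenic
pairs are dense; applying the same to B^T from a monogenic point produces
points at which both conditions hold, whence density of the bimonogenic A.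

The deformation comes from the fact that X commuting with B is nilpotent iff
it acts nilpotently on F^n / F^n B.  A flag of A-stable subspaces, from F^n B
up to F^n and compatible with the kernels of the powers of B, is built one
dimension at a time; at each step C is modified by a lift to the centralizer
of B of the rank one map sending the new flag vector to the preceding one.  In
the end A and C are both strictly triangular along the flag and C is a single
Jordan block on F^n / F^n B.

Structure of the algebra.  Let A be bimonogenic and e a cyclic row, so that
p |-> e *m pair_eval A B p identifies the generated algebra E with F^n.  The
maximal ideal of E consists of the p(A, B) with p(0) = 0, and the socle of E
corresponds to the rows killed by A and B, which form a line because
(A^T, B^T) is monogenic: E is Gorenstein ([cyclic_gorenstein]).  Let I be the
kernel of p |-> p(A, B) and m the ideal (X0, X1).  Writing p in I as
X0 q + X1 r, the pair (q(A, B), r(A, B)) is a Koszul 1-cycle whose class does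
not depend on the choice of q and r, and is zero iff p is in m I: thus I / m I
is the first Koszul homology of E.  The Euler characteristic of the Koszul
complex is zero, and its two extreme homologies are lines, so that I / m I has
dimension at most 2 ([kernel_two_generators_mod_maximal]).  Since I is finitely
generated, Nakayama over the local ring at the origin gives two generators of I there. *)

(** * Evaluation of bivariate polynomials at a commuting pair *)

Section PairEval.
Variables (F : fieldType) (R : algType F).
Implicit Types (a b : R) (p q : {mpoly F[2]}).

Definition X0 : {mpoly F[2]} := 'X_ord0.
Definition X1 : {mpoly F[2]} := 'X_ord_max.

Lemma mpolyX2 (m : 'X_{1..2}) :
  'X_[m] = X0 ^+ m ord0 * X1 ^+ m ord_max :> {mpoly F[2]}.
Proof.
rewrite mpolyXE_id big_ord_recl big_ord1 /X0 /X1.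
by rewrite (_ : lift ord0 ord0 = ord_max) //; apply: val_inj.
Qed.

(** Induction along the construction of polynomials by linear combinations and
    multiplication by the variables: this matches the closure properties of a
    generated algebra. *)
Lemma mpoly2_ind (P : {mpoly F[2]} -> Prop) :
    P 1 -> (forall p, P p -> P (X0 * p)) -> (forall p, P p -> P (X1 * p)) ->
    (forall c p, P p -> P (c *: p)) -> (forall p q, P p -> P q -> P (p + q)) ->
  forall p, P p.
Proof.
move=> P1 P0X P1X PZ PD; elim/mpolyind => [|c m p _ _ Pp].
  by rewrite -(scale0r 1); apply: PZ.
apply: PD Pp; apply: PZ; rewrite mpolyX2.
elim: (m ord0) => [|i IHi]; last by rewrite exprS -mulrA; apply: P0X.
rewrite mul1r; elim: (m _) => [|i IHi] //; rewrite exprS; exact: P1X.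
Qed.

Lemma mpoly2_decomp p : exists q r, p = (p.@[fun=> 0])%:MP + X0 * q + X1 * r.
Proof.
elim/mpoly2_ind: p => [|p _|p _|c p [q [r {1}->]]|p p' [q [r {1}->]] [q' [r' {1}->]]].
- by exists 0, 0; rewrite meval1 !mulr0 !addr0.
- by exists p, 0; rewrite mevalM mevalXU mul0r mulr0 addr0 mpolyC0 add0r.
- by exists 0, p; rewrite mevalM mevalXU mul0r mulr0 addr0 mpolyC0 add0r.
- exists (c *: q), (c *: r).
  by rewrite mevalZ !scalerDr -!scalerAr -mul_mpolyC -mpolyCM.
- exists (q + q'), (r + r'); rewrite mevalD mpolyCD; ring.
Qed.

Definition pair_eval a b p : R :=
  mmap (in_alg R) (fun i : 'I_2 => if i == ord0 then a else b) p.

Lemma pair_evalD a b : {morph pair_eval a b : p q / p + q}.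
Proof. exact: mmapD. Qed.
Lemma pair_evalB a b : {morph pair_eval a b : p q / p - q}.
Proof. exact: mmapB. Qed.
Lemma pair_evalZ a b c p : pair_eval a b (c *: p) = c *: pair_eval a b p.
Proof. by rewrite /pair_eval mmapZ mulr_algl. Qed.
Lemma pair_evalC a b c : pair_eval a b c%:MP = c%:A.
Proof. exact: mmapC. Qed.
Lemma pair_eval1 a b : pair_eval a b 1 = 1.
Proof. by rewrite -mpolyC1 pair_evalC scale1r. Qed.
Lemma pair_eval_mon a b m :
  pair_eval a b 'X_[m] = a ^+ m ord0 * b ^+ m ord_max.
Proof.
rewrite /pair_eval mmapX /mmap1 big_ord_recl big_ord1 /=.
by congr (_ * b ^+ m _); apply: val_inj.
Qed.

Lemma pair_evalX0 a b : pair_eval a b X0 = a.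
Proof. by rewrite pair_eval_mon !mnmE /= expr1 mulr1. Qed.
Lemma pair_evalX1 a b : pair_eval a b X1 = b.
Proof. by rewrite pair_eval_mon !mnmE /= expr1 mul1r. Qed.

Lemma pair_evalM a b : a * b = b * a -> {morph pair_eval a b : p q / p * q}.
Proof.
move=> ab p q.
elim/mpolyind: p => [|c m p _ _ IHp].
  by rewrite mul0r /pair_eval mmap0 mul0r.
rewrite mulrDl !pair_evalD mulrDl {}IHp; congr (_ + _).
rewrite -scalerAl !pair_evalZ -scalerAl; congr (_ *: _).
elim/mpolyind: q => [|c' m' q _ _ IHq].
  by rewrite mulr0 /pair_eval mmap0 mulr0.
rewrite mulrDr !pair_evalD mulrDr {}IHq; congr (_ + _).
rewrite -scalerAr !pair_evalZ -scalerAr; congr (_ *: _).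
rewrite -mpolyXD !pair_eval_mon !mnmDE !exprD.
have cm : GRing.comm (b ^+ m ord_max) (a ^+ m' ord0).
  by apply/commrX/commr_sym/commrX.
by rewrite !mulrA -(mulrA (a ^+ m ord0) (b ^+ m ord_max)) cm !mulrA.
Qed.

Lemma pair_evalXn a b p i :
  a * b = b * a -> pair_eval a b (p ^+ i) = pair_eval a b p ^+ i.
Proof.
by move=> ab; elim: i => [|i IH]; rewrite ?pair_eval1 // !exprS pair_evalM // IH.
Qed.

End PairEval.
Arguments X0 {F}.
Arguments X1 {F}.

(** * Deforming a commuting pair to a monogenic one *)

Section Functionals.
Variable F : fieldType.

(** Over a field a linear form that vanishes on the kernel of M factors
    through M. *)
Lemma kermx_factor m n (M : 'M[F]_(m, n)) (g : 'cV_m) :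
  kermx M *m g = 0 -> exists f, g = M *m f.
Proof.
move=> Mg; have /submxP[f gf] : (g^T <= M^T)%MS.
  rewrite submxE; apply/eqP/trmx_inj; rewrite trmx_mul trmxK trmx0.
  have /submxP[D ->] : ((cokermx M^T)^T <= kermx M)%MS.
    by apply/sub_kermxP/trmx_inj; rewrite trmx_mul trmxK mulmx_coker trmx0.
  by rewrite -mulmxA Mg mulmx0.
by exists f^T; rewrite -[LHS]trmxK gf trmx_mul trmxK.
Qed.

Lemma separating_functional m n (U : 'M[F]_(m, n)) (x : 'rV_n) :
  ~~ (x <= U)%MS -> exists2 g : 'cV_n, U *m g = 0 & x *m g = 1%:M.
Proof.
rewrite submxE => /rV0Pn[j]; set c := _ *m _ => cj0.
exists ((c 0 j)^-1 *: col j (cokermx U)).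
  by rewrite -scalemxAr colE mulmxA mulmx_coker mul0mx scaler0.
rewrite -scalemxAr colE mulmxA -/c; apply/matrixP => i k; rewrite !ord1.
by rewrite -colE [LHS]mxE [X in _ * X]mxE mulVf // mxE eqxx.
Qed.

End Functionals.

Section Deformation.
Variables (F : fieldType) (n : nat).
Implicit Types (A B C U X Y : 'M[F]_n.+1) (e : 'rV[F]_n.+1) (f g z : 'cV[F]_n.+1).

(** Some X, Y, z, e with X A + Y B + z e invertible exist iff
    F^n = F e + F^n A + F^n B for some row e.  The determinant form makes the
    condition visibly Zariski open in A. *)
Definition monogenic A B : Prop :=
  exists X Y z e, X *m A + Y *m B + z *m e \in unitmx.

(** Lifts to the centralizer of B the map v |-> (v B^k f) e on F^n / F^n B.  It
    is the composite of v |-> sum_j (v B^(k-j) f) T^j, a morphism to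
    F[T] / T^(k+1) because B^(k+1) f = 0, with T |-> B, 1 |-> e, a morphism
    from F[T] / T^(k+1) because e B^(k+1) = 0. *)
Lemma centralizer_rank1_lift B k e f :
    e *m B ^+ k.+1 = 0 -> B ^+ k.+1 *m f = 0 ->
  exists h Y, h * B = B * h /\ h = B ^+ k *m f *m e + Y * B.
Proof.
move=> eB Bf; pose T j i := B ^+ j *m f *m (e *m B ^+ i).
have TB j i : T j i * B = T j i.+1 by rewrite /T exprSr -mulmxE !mulmxA.
have BT j i : B * T j i = T j.+1 i by rewrite /T exprS -mulmxE !mulmxA.
exists (\sum_(i < k.+1) T (k - i)%N i), (\sum_(i < k) T (k - i.+1)%N i).
split.
  rewrite [in LHS]big_ord_recr [in RHS]big_ord_recl /= mulrDl mulrDr.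
  rewrite subn0 BT TB {2}/T {2}/T Bf eB mul0mx mulmx0 addr0 add0r.
  rewrite mulr_suml mulr_sumr; apply: eq_bigr => i _.
  by rewrite TB BT /bump /= add1n subnSK.
rewrite big_ord_recl /= subn0 {1}/T expr0 mulmx1; congr (_ + _).
by rewrite mulr_suml; apply: eq_bigr => i _; rewrite TB.
Qed.

(** One stage U of the flag that starts at F^n B.  Modulo F^n B, the map C has U
    as a cyclic subspace with generator e and maps everything into U C; the
    conditions on k say that e is killed by B^k while U already contains the kernel
    of B^(k-1), which is what the next rank one lift to the centralizer needs.
    The last field is the nilpotence, modulo F^n B, of all the combinations of
    A and C. *)
Record flag_state A B U k e C : Prop := FlagState {
  fs_B : (B <= U)%MS;
  fs_A : (U *m A <= U)%MS;
  fs_e : e *m B ^+ k = 0;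
  fs_ker : (kermx (B ^+ k.-1) <= U)%MS;
  fs_comm : C * B = B * C;
  fs_gen : (U :=: e + U *m C + B)%MS;
  fs_C : (C <= U *m C + B)%MS;
  fs_nil : forall s t, exists j, (U *m (s *: A + t *: C) ^+ j <= B)%MS
}.

Lemma flag_state0 A B : A * B = B * A -> flag_state A B B 0 0 0.
Proof.
move=> AB; split.
- by [].
- by rewrite mulmxE -AB -mulmxE submxMl.
- by rewrite mul0mx.
- by rewrite expr0; have /eqP-> : kermx (1 : 'M[F]_n.+1) == 0;
    rewrite ?sub0mx // kermx_eq0 row_free_unit unitmx1.
- by rewrite mul0r mulr0.
- by rewrite mulmx0; apply/eqmxP; rewrite !addsmx_sub !sub0mx submx_refl addsmxSr.
- exact: sub0mx.
- by move=> s t; exists 0%N; rewrite expr0 mulmx1.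
Qed.

Lemma sub_commB B X : X * B = B * X -> (B *m X <= B)%MS.
Proof. by move=> XB; rewrite mulmxE -XB -mulmxE submxMl. Qed.

(** The new flag vector e' is taken in the kernel of the first power of B whose
    kernel is not inside U, and is pushed by A until its image under A falls in
    U.  Adding to C the lift h of the map that sends e' to e and kills U makes e'
    a generator of U' = U + F e': e' C' is e modulo F^n B and F^n C, hence
    generates U. *)
Lemma flag_state_step A B U k e C :
    A * B = B * A -> nilpotent_mx A -> nilpotent_mx B ->
    flag_state A B U k e C -> ~~ row_full U ->
  exists U' k' e' C', flag_state A B U' k' e' C' /\ (\rank U < \rank U')%N.
Proof.
move=> AB [NA A0] [NB B0] [UB UA eBk kerU CB Ugen CU Unil] nfU.
have eU : (e <= U)%MS by rewrite Ugen -addsmxA addsmxSl.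
have CsubU : (C <= U)%MS.
  by apply: (submx_trans CU); rewrite Ugen -addsmxA addsmxSr.
have exj : exists j, ~~ (kermx (B ^+ j) <= U)%MS.
  exists NB; rewrite B0; apply: contra nfU => /(submx_trans _) sU.
  by rewrite -sub1mx sU //; apply/sub_kermxP; rewrite mulmx0.
(* k0.+1 is the least exponent whose kernel is not contained in U. *)
case: (ex_minnP exj) => -[|k0] /= kerNU minj.
  case/negP: kerNU; rewrite expr0.
  have /eqP-> : kermx (1 : 'M[F]_n.+1) == 0; rewrite ?sub0mx //.
  by rewrite kermx_eq0 row_free_unit unitmx1.
have ker0U : (kermx (B ^+ k0) <= U)%MS.
  by apply: contraT => /minj; rewrite ltnn.
(* Minimality of k0 and the kernel condition at stage k keep the exponents
   increasing, so that the old generator e is killed by B^(k0.+1) too. *)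
have lek : (k <= k0.+1)%N.
  rewrite leqNgt; apply/negP => ltk; case/negP: kerNU.
  apply: submx_trans kerU; apply/sub_kermxP.
  rewrite -(subnKC (_ : k0.+1 <= k.-1)%N) ?exprD; last by rewrite -ltnS (ltn_predK ltk).
  by rewrite -mulmxE mulmxA mulmx_ker mul0mx.
have eB : e *m B ^+ k0.+1 = 0.
  by rewrite -(subnKC lek) exprD -mulmxE mulmxA eBk mul0mx.
have [x xker xU] : exists2 x : 'rV_n.+1, x *m B ^+ k0.+1 = 0 & ~~ (x <= U)%MS.
  case/row_subPn: kerNU => i Hi; exists (row i (kermx (B ^+ k0.+1))) => //.
  by rewrite -row_mul mulmx_ker row0.
have exi : exists i, (x *m A ^+ i <= U)%MS by exists NA; rewrite A0 mulmx0 sub0mx.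
case: (ex_minnP exi) => -[|i] /= xAi mini.
  by rewrite expr0 mulmx1 (negPf xU) in xAi.
pose e' := x *m A ^+ i.
have e'U : ~~ (e' <= U)%MS by apply/negP => /mini; rewrite ltnn.
have e'A : (e' *m A <= U)%MS by rewrite -mulmxA mulmxE -exprSr.
have e'B : e' *m B ^+ k0.+1 = 0.
  rewrite -mulmxA mulmxE; have -> : A ^+ i * B ^+ k0.+1 = B ^+ k0.+1 * A ^+ i.
    by apply/commrX/commr_sym/commrX.
  by rewrite -mulmxE mulmxA xker mul0mx.
have [g Ug e'g] := separating_functional e'U.
have subUg m (W : 'M_(m, _)) : (W <= U)%MS -> W *m g = 0.
  by case/submxP => D ->; rewrite -mulmxA Ug mulmx0.
have [f gf] := kermx_factor (subUg _ _ ker0U).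
have Bf : B ^+ k0.+1 *m f = 0.
  by rewrite exprS -mulmxE -mulmxA -gf subUg.
have [h [Y [hB]]] := centralizer_rank1_lift eB Bf.
rewrite -gf => hE.
pose C' := C + h; pose U' := (U + e')%MS.
have C'B : C' * B = B * C' by rewrite mulrDl mulrDr CB hB.
have hU : (h <= U)%MS.
  by rewrite hE addmx_sub ?(submx_trans (submxMl _ _)).
have C'U : (C' <= U)%MS by rewrite addmx_sub.
(* On U the modified map agrees with C modulo F^n B. *)
have WC' m (W : 'M_(m, _)) : (W <= U)%MS -> exists Z, W *m C' = W *m C + Z *m B.
  move=> WU; exists (W *m Y).
  by rewrite mulmxDr hE mulmxDr !mulmxA (subUg _ _ WU) mul0mx add0r -!mulmxA mulmxE.
have UC : (U *m C <= U' *m C' + B)%MS.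
  have [Z ZE] := WC' _ U (submx_refl U).
  have -> : U *m C = U *m C' - Z *m B by rewrite ZE addrK.
  apply: addmx_sub_adds; last by rewrite eqmx_opp submxMl.
  by rewrite submxMr ?addsmxSl.
have CU' : (C <= U' *m C' + B)%MS.
  by rewrite (submx_trans CU) // addsmx_sub UC addsmxSr.
have eU' : (e <= U' *m C' + B)%MS.
  have -> : e = e' *m C' - e' *m C - (e' *m Y) *m B.
    rewrite mulmxDr hE mulmxDr -mulmxE !mulmxA e'g mul1mx.
    by rewrite (addrC (e' *m C)) addrK addrK.
  rewrite addmx_sub ?eqmx_opp //; last first.
    by rewrite (submx_trans (submxMl _ _)) // addsmxSr.
  rewrite addmx_sub ?eqmx_opp //; last exact: submx_trans (submxMl _ _) CU'.
  by rewrite (submx_trans _ (addsmxSl _ _)) // submxMr // addsmxSr.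
have UU' : (U <= U' *m C' + B)%MS.
  by rewrite Ugen !addsmx_sub eU' UC addsmxSr.
have UX m (W : 'M_(m, _)) s t : (W <= U)%MS ->
    (W *m (s *: A + t *: C') <= W *m (s *: A + t *: C) + B)%MS.
  move=> WU; have [Z ZE] := WC' _ W WU.
  rewrite mulmxDr -[W *m (t *: C')]scalemxAr ZE scalerDr scalemxAr addrA -mulmxDr.
  by rewrite addmx_sub_adds // scalemx_sub // submxMl.
exists U', k0.+1, e', C'; split; first split => //.
- exact: submx_trans UB (addsmxSl _ _).
- rewrite addsmxMr addsmx_sub !(submx_trans _ (addsmxSl _ _)) //.
- exact: submx_trans ker0U (addsmxSl _ _).
- apply/eqmxP; rewrite !addsmx_sub addsmxSr (submx_trans UB (addsmxSl _ _)).
  rewrite (submx_trans (submxMl _ _) (submx_trans C'U (addsmxSl _ _))) !andbT.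
  by rewrite -addsmxA addsmxSl andbT (submx_trans UU') // addsmxSr.
- exact: submx_trans C'U UU'.
- move=> s t; have [j Hj] := Unil s t; exists j.+1.
  set X' := s *: A + t *: C'; set X := s *: A + t *: C in Hj.
  have BX' : (B *m X' <= B)%MS.
    apply: sub_commB; rewrite /X' mulrDl mulrDr -!scalerAl -!scalerAr.
    by rewrite AB C'B.
  have UXU i' : (U *m X ^+ i' <= U)%MS.
    elim: i' => [|i' IH]; first by rewrite expr0 mulmx1.
    rewrite exprSr -mulmxE mulmxA (submx_trans (submxMr _ IH)) //.
    rewrite mulmxDr addmx_sub // -scalemxAr scalemx_sub //.
    exact: submx_trans (submxMl _ _) CsubU.
  have UX'j i' : (U *m X' ^+ i' <= U *m X ^+ i' + B)%MS.
    elim: i' => [|i' IH]; first by rewrite !expr0 addsmxSl.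
    rewrite !exprSr -!mulmxE !mulmxA (submx_trans (submxMr _ IH)) //.
    rewrite addsmxMr addsmx_sub UX //=; exact: submx_trans BX' (addsmxSr _ _).
  have U'X' : (U' *m X' <= U)%MS.
    rewrite mulmxDr addmx_sub // -scalemxAr scalemx_sub //.
      by rewrite addsmxMr addsmx_sub UA.
    exact: submx_trans (submxMl _ _) C'U.
  rewrite exprS -mulmxE mulmxA (submx_trans (submxMr _ U'X')) //.
  by rewrite (submx_trans (UX'j j)) // addsmx_sub Hj submx_refl.
rewrite ltn_neqAle mxrankS ?addsmxSl // andbT.
apply: contra e'U => /eqP rk.
have /andP[_ sub] : (U == U')%MS.
  by rewrite -(geq_leqif (mxrank_leqif_eq (addsmxSl U e'))) rk.
exact: submx_trans (addsmxSr _ _) sub.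
Qed.

Lemma full_flag_state A B :
    A * B = B * A -> nilpotent_mx A -> nilpotent_mx B ->
  exists U k e C, flag_state A B U k e C /\ row_full U.
Proof.
move=> AB nA nB.
suff grow d : forall U k e C, (n.+1 - \rank U <= d)%N -> flag_state A B U k e C ->
    exists U' k' e' C', flag_state A B U' k' e' C' /\ row_full U'.
  exact: grow (leqnn _) (flag_state0 AB).
elim: d => [|d IHd] U k e C leUd st.
  exists U, k, e, C; split=> //.
  by rewrite /row_full eqn_leq rank_leq_col -subn_eq0 -leqn0.
have [fU|nfU] := boolP (row_full U); first by exists U, k, e, C.
have [U' [k' [e' [C' [st' ltU]]]]] := flag_state_step AB nA nB st nfU.
apply: IHd st'; rewrite -ltnS; apply: leq_trans leUd.
by rewrite ltn_sub2l // (leq_trans ltU) // rank_leq_col.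
Qed.

(** X^j = D B gives X^(j m) in the left ideal of B^m, as X commutes with B. *)
Lemma nilpotent_mod_nilpotent B X j :
    X * B = B * X -> nilpotent_mx B -> (X ^+ j <= B)%MS -> nilpotent_mx X.
Proof.
move=> XB [m B0] /submxP[D XD]; exists (j * m)%N.
suff [E ->] : exists E, X ^+ (j * m) = E * B ^+ m by rewrite B0 mulr0.
elim: {B0} m => [|m [E IH]]; first by exists 1; rewrite muln0 mulr1.
exists (E * D); rewrite mulnS addnC exprD IH -mulrA.
have -> : B ^+ m * X ^+ j = X ^+ j * B ^+ m by apply/commrX/commr_sym/commrX.
by rewrite XD mulmxE exprS !mulrA.
Qed.

(** At the last stage of the flag, U is everything: its cyclicity modulo F^n B
    is monogenicity, and nilpotence modulo F^n B is nilpotence. *)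
Lemma cyclic_deformation A B :
    A * B = B * A -> nilpotent_mx A -> nilpotent_mx B ->
  exists C, [/\ C * B = B * C, monogenic C B &
                forall s t, nilpotent_mx (s *: A + t *: C)].
Proof.
move=> AB nA nB; have [U [k [e [C [st fU]]]]] := full_flag_state AB nA nB.
case: st => _ _ _ _ CB Ugen _ Unil; exists C; split=> //.
  have : (1%:M <= (e + C) + B)%MS.
    move: fU; rewrite -sub1mx => /submx_trans; apply.
    by rewrite Ugen !addsmxS ?submxMl.
  case/sub_addsmxP=> -[D1 D2] /= D.
  have /sub_addsmxP[[E1 E2] /= E] : (D1 *m (e + C)%MS <= e + C)%MS by exact: submxMl.
  exists E2, D2, E1, e; rewrite addrAC (addrC (E2 *m C)) -E -D; exact: unitmx1.
move=> s t; have [j Uj] := Unil s t; apply: (nilpotent_mod_nilpotent (j := j) _ nB).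
  by rewrite mulrDl mulrDr -!scalerAl -!scalerAr AB CB.
move: fU; rewrite -sub1mx => /(submxMr ((s *: A + t *: C) ^+ j)).
by rewrite mul1mx => /submx_trans; apply.
Qed.

End Deformation.

(** * The generated algebra and its cyclic vectors *)

Section GeneratedAlgebra.
Variables (F : fieldType) (n : nat).
Implicit Types (A B X : 'M[F]_n.+1) (p q : {mpoly F[2]}).

Lemma gen_alg_1 A B : 1 \in gen_alg A B.
Proof. by rewrite memvE sub1_agenv. Qed.
Lemma gen_alg_l A B : A \in gen_alg A B.
Proof. by apply: seqv_sub_adjoin; rewrite !inE eqxx. Qed.
Lemma gen_alg_r A B : B \in gen_alg A B.
Proof. by apply: seqv_sub_adjoin; rewrite !inE eqxx orbT. Qed.

Lemma mem_gen_alg A B X : A * B = B * A ->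
  (X \in gen_alg A B) <-> (exists p, X = pair_eval A B p).
Proof.
move=> AB; split=> [|[p ->]]; last first.
  elim/mpoly2_ind: p => [|p Ep|p Ep|c p Ep|p q Ep Eq].
  - by rewrite pair_eval1 gen_alg_1.
  - by rewrite pair_evalM // pair_evalX0 memvM ?gen_alg_l.
  - by rewrite pair_evalM // pair_evalX1 memvM ?gen_alg_r.
  - by rewrite pair_evalZ memvZ.
  - by rewrite pair_evalD memvD.
case/memv_sumP=> Y EY ->; elim/big_ind: _ => [|_ _ [p ->] [q ->]|i _].
- by exists 0; rewrite /pair_eval mmap0.
- by exists (p + q); rewrite pair_evalD.
move: {Y EY}(Y i) (EY i isT) => Y; rewrite span_cons span_seq1.
elim: (i : nat) Y => [|k IHk] Y.
  by rewrite expv0 => /vlineP[c ->]; exists c%:MP; rewrite pair_evalC.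
rewrite expvSr !prodvDr prodv1 -!limg_amulr.
case/memv_addP=> _ /IHk[p ->] [_ /memv_addP[_ /memv_imgP[_ /IHk[q ->] ->]
  [_ /memv_imgP[_ /IHk[r ->] ->] ->]] ->].
exists (p + (q * X0 + r * X1)).
by rewrite !pair_evalD !pair_evalM // pair_evalX0 pair_evalX1 !lfunE.
Qed.

Lemma tr_pair_eval A B p : A * B = B * A ->
  (pair_eval A B p)^T = pair_eval A^T B^T p.
Proof.
move=> AB; have AB' : A^T * B^T = B^T * A^T by rewrite -!mulmxE -!trmx_mul !mulmxE AB.
elim/mpoly2_ind: p => [|p Ep|p Ep|c p Ep|p q Ep Eq].
- by rewrite !pair_eval1 trmx1.
- rewrite {1}mulrC (pair_evalM AB) (pair_evalM AB') !pair_evalX0 -Ep.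
  by rewrite -!mulmxE trmx_mul.
- rewrite {1}mulrC (pair_evalM AB) (pair_evalM AB') !pair_evalX1 -Ep.
  by rewrite -!mulmxE trmx_mul.
- by rewrite !pair_evalZ -Ep; apply: linearZ.
- by rewrite !pair_evalD -Ep -Eq; apply: linearD.
Qed.

(** Nakayama: iterating v = c e + a A + b B first exhausts the powers of A
    modulo F^n B, then the powers of B. *)
Lemma monogenic_cyclic A B :
    A * B = B * A -> nilpotent_mx A -> nilpotent_mx B -> monogenic A B ->
  exists e : 'rV_n.+1, forall v, exists p, v = e *m pair_eval A B p.
Proof.
move=> AB [k Ak0] [l Bl0] [X [Y [z [e Gunit]]]]; exists e.
have gen v : exists c a b, v = c *: e + a *m A + b *m B.
  pose w := v *m invmx (X *m A + Y *m B + z *m e).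
  exists ((w *m z) 0 0), (w *m X), (w *m Y).
  rewrite -[LHS](mulmxKV Gunit) -/w -mul_scalar_mx -mx11_scalar !mulmxDr !mulmxA.
  by rewrite addrC addrA.
pose sp v := exists p, v = e *m pair_eval A B p.
have spD v w : sp v -> sp w -> sp (v + w).
  by move=> [p ->] [q ->]; exists (p + q); rewrite pair_evalD mulmxDr.
have spM v p : sp v -> sp (v *m pair_eval A B p).
  by move=> [q ->]; exists (q * p); rewrite pair_evalM // -mulmxA.
have sp_e c : sp (c *: e).
  by exists c%:MP; rewrite pair_evalC -scalemxAr mulmx1.
have spB v : exists b, sp (v - b *m B).
  suff [a [b]] : exists a b, sp (v - a *m A ^+ k - b *m B).
    by rewrite Ak0 mulmx0 subr0; exists b.
  elim: (k) => [|i [a [b sab]]].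
    exists v, 0; rewrite mulmx1 mul0mx !subrr; exists 0.
    by rewrite /pair_eval mmap0 mulmx0.
  have [c [a' [b' aE]]] := gen a.
  exists a', (b + b' *m A ^+ i).
  have -> : v - a' *m A ^+ i.+1 - (b + b' *m A ^+ i) *m B =
      (v - a *m A ^+ i - b *m B) + c *: e *m pair_eval A B (X0 ^+ i).
    rewrite pair_evalXn // pair_evalX0 aE !mulmxDl exprS -mulmxE !mulmxA.
    have -> : b' *m A ^+ i *m B = b' *m B *m A ^+ i.
      by rewrite -!mulmxA !mulmxE; congr (_ *m _); apply/commr_sym/commrX.
    move: (c *: e *m _) (_ *m A *m _) (_ *m B *m _) (b *m B) => T Q P S.
    by apply/rowP => j; rewrite !mxE; ring.
  by apply: spD sab _; apply: spM.
move=> v.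
suff [b] : exists b, sp (v - b *m B ^+ l) by rewrite Bl0 mulmx0 subr0.
elim: (l) => [|j [b sb]].
  by exists v; rewrite mulmx1 subrr; exists 0; rewrite /pair_eval mmap0 mulmx0.
have [b' sb'] := spB b; exists b'.
have -> : v - b' *m B ^+ j.+1 = (v - b *m B ^+ j) + (b - b' *m B) *m pair_eval A B (X1 ^+ j).
  rewrite pair_evalXn // pair_evalX1 mulmxBl exprS -mulmxE !mulmxA.
  by rewrite addrA addrNK.
by apply: spD sb _; apply: spM.
Qed.

End GeneratedAlgebra.

(** * Zariski density of bimonogenic pairs *)

Section EntryPolynomials.
Variables (F : fieldType) (n : nat).
Implicit Types (A B D X Y : 'M[F]_n) (p q : {mpoly F[n * n]}).

Definition generic_mx : 'M[{mpoly F[n * n]}]_n := \matrix_(i, j) 'X_(mxvec_index i j).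

Lemma entry_evalM p q A : entry_eval (p * q) A = entry_eval p A * entry_eval q A.
Proof. exact: mevalM. Qed.

Lemma entry_eval_generic A :
  map_mx (meval (fun k => mxvec A 0 k)) generic_mx = A.
Proof. by apply/matrixP => i j; rewrite !mxE mevalXU mxvecE. Qed.

Definition affine_det_poly X Y : {mpoly F[n * n]} :=
  \det (map_mx (@mpolyC _ _) X *m generic_mx + map_mx (@mpolyC _ _) Y).

Lemma map_mevalC v X : map_mx (meval v) (map_mx (@mpolyC (n * n) F) X) = X.
Proof. by apply/matrixP => i j; rewrite !mxE mevalC. Qed.

Lemma entry_eval_det X Y A :
  entry_eval (affine_det_poly X Y) A = \det (X *m A + Y).
Proof.
by rewrite /entry_eval -det_map_mx map_mxD map_mxM !map_mevalC entry_eval_generic.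
Qed.

(** The polynomial function A |-> p (A^T). *)
Definition tr_entries p : {mpoly F[n * n]} :=
  comp_mpoly [tuple mxvec generic_mx^T 0 k | k < n * n] p.

Lemma entry_eval_tr p A : entry_eval (tr_entries p) A = entry_eval p A^T.
Proof.
rewrite /entry_eval /tr_entries comp_mpoly_meval; apply: meval_eq => k.
rewrite tnth_map tnth_ord_tuple; case/mxvec_indexP: k => i j.
by rewrite !mxvecE !mxE mevalXU mxvecE.
Qed.

Lemma entry_eval_line p A D :
  exists q : {poly F}, forall t, q.[t] = entry_eval p (A + t *: D).
Proof.
exists (\sum_(m <- msupp p) p@_m *:
  \prod_i ((mxvec A 0 i)%:P + (mxvec D 0 i) *: 'X) ^+ m i) => t.
rewrite /entry_eval mevalE horner_sum; apply: eq_bigr => m _.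
rewrite hornerZ horner_prod; congr (_ * _); apply: eq_bigr => i _.
by rewrite horner_exp hornerD hornerC hornerZ hornerX linearD linearZ /= !mxE mulrC.
Qed.

End EntryPolynomials.

(** A nonconstant q takes the value 1, since q - 1 has a root. *)
Lemma closed_nonroot (F : closedFieldType) (q : {poly F}) :
  q != 0 -> exists t, q.[t] != 0.
Proof.
move=> q0; have [/eqP/size_poly1P[c c0 ->]|sq] := eqVneq (size q) 1%N.
  by exists 0; rewrite hornerC.
have sq1 : (1 < size q)%N by rewrite ltn_neqAle eq_sym sq size_poly_gt0.
have /closed_rootP[t] : size (q - 1) != 1%N.
  by rewrite size_polyDl // size_polyN size_poly1.
rewrite rootE hornerD hornerN hornerC subr_eq0 => /eqP qt.
by exists t; rewrite qt oner_neq0.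
Qed.

Section Generic.
Variables (F : closedFieldType) (n : nat).
Implicit Types (A B C D X Y : 'M[F]_n.+1) (p q : {mpoly F[n.+1 * n.+1]}).

Lemma nonvanishing_line p q A D :
    entry_eval p A != 0 -> entry_eval q (A + D) != 0 ->
  exists t, entry_eval p (A + t *: D) != 0 /\ entry_eval q (A + t *: D) != 0.
Proof.
move=> pA qD; have [p' p'E] := entry_eval_line p A D.
have [q' q'E] := entry_eval_line q A D.
have /closed_nonroot[t] : p' * q' != 0.
  rewrite mulf_neq0 //; apply/eqP => z0.
    by have := p'E 0; rewrite z0 horner0 scale0r addr0 => /esym/eqP; rewrite (negPf pA).
  by have := q'E 1; rewrite z0 horner0 scale1r => /esym/eqP; rewrite (negPf qD).
by rewrite hornerM p'E q'E mulf_eq0 negb_or => /andP[pt qt]; exists t.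
Qed.

Lemma monogenicP A B :
  monogenic A B <-> exists X Y z e,
    entry_eval (affine_det_poly X (Y *m B + z *m (e : 'rV_n.+1))) A != 0.
Proof.
by split=> -[X [Y [z [e H]]]]; exists X, Y, z, e; move: H;
  rewrite entry_eval_det addrA unitmxE unitfE.
Qed.

Lemma monogenic_trP A B :
  monogenic A^T B^T <-> exists X Y z e,
    entry_eval (tr_entries (affine_det_poly X (Y *m B^T + z *m (e : 'rV_n.+1)))) A != 0.
Proof.
by split=> [/monogenicP|] [X [Y [z [e H]]]]; [|apply/monogenicP];
  exists X, Y, z, e; move: H; rewrite entry_eval_tr.
Qed.

(** The line from A to the C of [cyclic_deformation] stays in the nilpotent
    commutator, p is nonzero at its origin and a determinant witnessing
    monogenicity is nonzero at C. *)
Lemma monogenic_dense A B p :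
    nilpotent_mx B -> nilp_commutator B A -> entry_eval p A != 0 ->
  exists A', [/\ nilp_commutator B A', entry_eval p A' != 0 & monogenic A' B].
Proof.
move=> nB [nA AB] pA; have [C [CB gC nC]] := cyclic_deformation AB nA nB.
case/monogenicP: gC => X [Y [z [e qC]]].
have qD : entry_eval (affine_det_poly X (Y *m B + z *m e)) (A + (C - A)) != 0.
  by rewrite [A + _]addrC subrK.
have [t [pt qt]] := nonvanishing_line pA qD.
exists (A + t *: (C - A)); split=> //; last by apply/monogenicP; exists X, Y, z, e.
split; last first.
  by rewrite mulrDl mulrDr -scalerAl -scalerAr mulrBl mulrBr AB CB.
have -> : A + t *: (C - A) = (1 - t) *: A + t *: C; last exact: nC.
by apply/matrixP => i j; rewrite !mxE; ring.
Qed.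

Lemma nilpotent_tr A : nilpotent_mx A -> nilpotent_mx A^T.
Proof.
move=> [k Ak]; exists k; apply: trmx_inj; rewrite trmx0 -Ak.
elim: (k) => [|i IH]; first by rewrite trmx1.
by rewrite exprS exprSr -!mulmxE trmx_mul trmxK IH.
Qed.

Lemma nilp_commutator_tr A B : nilp_commutator B A -> nilp_commutator B^T A^T.
Proof.
move=> [nA AB]; split; first exact: nilpotent_tr.
by rewrite -!mulmxE -!trmx_mul !mulmxE AB.
Qed.

Definition bimonogenic B A := monogenic A B /\ monogenic A^T B^T.

(** From a monogenic point, the density for B^T is applied to the product of p
    and of a determinant witnessing monogenicity, so that moving to make the
    transposed pair monogenic does not lose the first property. *)
Lemma bimonogenic_dense A B p :
    nilpotent_mx B -> nilp_commutator B A -> entry_eval p A != 0 ->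
  exists A', [/\ nilp_commutator B A', entry_eval p A' != 0 & bimonogenic B A'].
Proof.
move=> nB NA pA; have [A1 [NA1 pA1 /monogenicP[X [Y [z [e qA1]]]]]] := monogenic_dense nB NA pA.
pose q := p * affine_det_poly X (Y *m B + z *m e).
have qA1' : entry_eval (tr_entries q) A1^T != 0.
  by rewrite entry_eval_tr trmxK entry_evalM mulf_neq0.
have [A2 [NA2 qA2 gA2]] :=
  monogenic_dense (nilpotent_tr nB) (nilp_commutator_tr NA1) qA1'.
have := nilp_commutator_tr NA2; rewrite trmxK => NA2'.
move: qA2; rewrite entry_eval_tr entry_evalM mulf_eq0 negb_or => /andP[pA2 qA2].
exists A2^T; split=> //; split; last by rewrite trmxK.
by apply/monogenicP; exists X, Y, z, e.
Qed.

Lemma bimonogenic_open B : zariski_open_in (nilp_commutator B)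
  (fun A => nilp_commutator B A /\ bimonogenic B A).
Proof.
exists (fun p => exists X Y z (e : 'rV_n.+1) X' Y' z' (e' : 'rV_n.+1),
  p = affine_det_poly X (Y *m B + z *m e) *
      tr_entries (affine_det_poly X' (Y' *m B^T + z' *m e'))) => A.
split=> [[NA [/monogenicP[X [Y [z [e q]]]] /monogenic_trP[X' [Y' [z' [e' q']]]]]]|].
  split=> //; eexists; first by exists X, Y, z, e, X', Y', z', e'.
  by rewrite entry_evalM mulf_neq0.
case=> NA [_ [X [Y [z [e [X' [Y' [z' [e' ->]]]]]]]]].
rewrite entry_evalM mulf_eq0 negb_or => /andP[q q']; split=> //.
by split; [apply/monogenicP; exists X, Y, z, e|apply/monogenic_trP; exists X', Y', z', e'].
Qed.

Lemma bimonogenic_generic B P :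
    nilpotent_mx B -> (forall A, nilp_commutator B A -> bimonogenic B A -> P A) ->
  generic_in (nilp_commutator B) P.
Proof.
move=> nB gP; exists (fun A => nilp_commutator B A /\ bimonogenic B A); split.
- exact: bimonogenic_open.
- have N0 : nilp_commutator B 0 by split; [exists 1%N; rewrite expr1 | rewrite mul0r mulr0].
  have [|A [NA _ gA]] := @bimonogenic_dense 0 B 1 nB N0; last by exists A.
  by rewrite /entry_eval meval1 oner_neq0.
- by move=> A [NA gA]; apply: gP.
Qed.

Lemma monogenic_cyclic_vector A B :
    nilpotent_mx A -> nilpotent_mx B -> A * B = B * A -> monogenic A B ->
  has_cyclic_vector (gen_alg A^T B^T).
Proof.
move=> nA nB AB gAB; have [e cyc] := monogenic_cyclic AB nA nB gAB.
exists e^T => u; have [p up] := cyc u^T; exists (pair_eval A^T B^T p).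
  by apply/mem_gen_alg; [rewrite -!mulmxE -!trmx_mul !mulmxE AB | exists p].
by rewrite -tr_pair_eval // -trmx_mul -up trmxK.
Qed.

Lemma bimonogenic_cyclic A B :
    nilpotent_mx B -> nilp_commutator B A -> bimonogenic B A ->
  has_cyclic_vector (gen_alg A B) /\ has_cyclic_vector (gen_alg A^T B^T).
Proof.
move=> nB [nA AB] [g g']; split; last exact: monogenic_cyclic_vector.
rewrite -[A]trmxK -[B]trmxK.
apply: monogenic_cyclic_vector; rewrite ?trmxK //; try exact: nilpotent_tr.
by rewrite -!mulmxE -!trmx_mul !mulmxE AB.
Qed.

End Generic.

(** * The generated algebra is local and Gorenstein *)

Section LocalPair.
Variables (F : fieldType) (n : nat) (A B : 'M[F]_n.+1).
Hypotheses (AB : A * B = B * A) (nA : nilpotent_mx A) (nB : nilpotent_mx B).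
Local Notation phi := (pair_eval A B).
Local Notation E := (gen_alg A B).
Implicit Types (p q : {mpoly F[2]}) (u v e : 'rV[F]_n.+1) (X : 'M[F]_n.+1).

Lemma pair_eval_comm p q : phi p * phi q = phi q * phi p.
Proof. by rewrite -!pair_evalM // mulrC. Qed.

Lemma nilpotent_last_nonzero v X : v != 0 -> nilpotent_mx X ->
  exists i, v *m X ^+ i != 0 /\ v *m X ^+ i *m X = 0.
Proof.
move=> v0 [k Xk].
have exi : exists i, v *m X ^+ i == 0 by exists k; rewrite Xk mulmx0.
case: (ex_minnP exi) => -[|i]; first by rewrite mulmx1 (negPf v0).
rewrite exprSr -mulmxE mulmxA => /eqP vX mini; exists i; split=> //.
by apply/negP => /mini; rewrite ltnn.
Qed.

Lemma common_kernel : exists u, [/\ u != 0, u *m A = 0 & u *m B = 0].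
Proof.
have d0 : delta_mx 0 0 != 0 :> 'rV[F]_n.+1.
  by apply/rV0Pn; exists 0; rewrite mxE !eqxx oner_neq0.
have [i [w0 wA]] := nilpotent_last_nonzero d0 nA.
have [j [u0 uB]] := nilpotent_last_nonzero w0 nB.
exists (delta_mx 0 0 *m A ^+ i *m B ^+ j); split=> //.
rewrite -mulmxA mulmxE; have -> : B ^+ j * A = A * B ^+ j.
  by apply/commr_sym/commrX.
by rewrite -mulmxE mulmxA wA mul0mx.
Qed.

Lemma pair_eval_kernel u p :
  u *m A = 0 -> u *m B = 0 -> u *m phi p = p.@[fun=> 0] *: u.
Proof.
move=> uA uB; have [q [r {1}->]] := mpoly2_decomp p.
rewrite !pair_evalD pair_evalC !pair_evalM // pair_evalX0 pair_evalX1.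
rewrite -!mulmxE !mulmxDr !mulmxA uA uB !mul0mx !addr0.
by rewrite -scalemxAr mulmx1.
Qed.

(** The power p^k is in the ideal (X0^k, X1), so that p(A, B)^k is a multiple
    of B once A^k = 0. *)
Lemma pair_eval_nilpotent p : p.@[fun=> 0] = 0 -> nilpotent_mx (phi p).
Proof.
move=> p0; have [q [r pE]] := mpoly2_decomp p; rewrite p0 mpolyC0 add0r in pE.
have [k Ak] := nA.
have [s ps] : exists s, p ^+ k = q ^+ k * X0 ^+ k + s * X1.
  elim: (k) => [|i [s IH]]; first by exists 0; rewrite !expr0 mul0r addr0 mulr1.
  exists (p * s + r * q ^+ i * X0 ^+ i); rewrite !exprS IH {1 2}pE.
  ring.
apply: (nilpotent_mod_nilpotent (j := k) _ nB).
  by have := pair_eval_comm p X1; rewrite pair_evalX1.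
rewrite -pair_evalXn // ps pair_evalD !pair_evalM // !pair_evalXn //.
by rewrite pair_evalX0 pair_evalX1 Ak mulr0 add0r -mulmxE submxMl.
Qed.

(** p(A, B) is a nonzero scalar up to a nilpotent, hence invertible. *)
Lemma pair_eval_cancel p q :
  p.@[fun=> 0] != 0 -> phi p * phi q = 0 -> phi q = 0.
Proof.
set c := p.@[_] => c0 pq.
have [|k mk] := @pair_eval_nilpotent (1 - c^-1 *: p).
  by rewrite mevalB meval1 mevalZ mulVf // subrr.
suff <- : phi (1 - c^-1 *: p) ^+ k * phi q = phi q by rewrite mk mul0r.
elim: (k) => [|i IH]; first by rewrite mul1r.
rewrite exprSr -mulrA pair_evalB pair_evalZ pair_eval1 mulrBl mul1r.
by rewrite -[X in _ * (_ - X)]scalerAl pq scaler0 subr0 -{2}IH pair_evalB pair_evalZ pair_eval1.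
Qed.

Lemma gen_alg_comm : is_comm_alg E.
Proof.
move=> x y /(mem_gen_alg _ AB)[p ->] /(mem_gen_alg _ AB)[q ->].
exact: pair_eval_comm.
Qed.

Lemma is_idealP (I : {vspace 'M[F]_n.+1}) :
  reflect ((forall x, x \in I -> x \in E) /\
           forall x y, x \in E -> y \in I -> x * y \in I) (is_ideal E I).
Proof.
apply: (iffP andP) => -[H1 H2]; split.
- exact/subvP.
- by move=> x y xE yI; apply: (subvP H2); apply: memv_mul.
- exact/subvP.
- by apply/prodvP.
Qed.

Section CommonKernel.
Variable u : 'rV[F]_n.+1.
Hypotheses (u0 : u != 0) (uA : u *m A = 0) (uB : u *m B = 0).

(** A common eigenvector u turns the residue map E -> F into x |-> u x, whose
    kernel is linear-algebraic and consists of the p(A, B) with p(0) = 0. *)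
Definition augmentation_ideal : {vspace 'M[F]_n.+1} := (E :&: lker (linfun (mulmx u)))%VS.
Local Notation M := augmentation_ideal.

Lemma mem_augmentation p : (phi p \in M) = (p.@[fun=> 0] == 0).
Proof.
have Ep : phi p \in E by apply/mem_gen_alg => //; exists p.
by rewrite memv_cap Ep memv_ker lfunE /= pair_eval_kernel // scaler_eq0 (negPf u0) orbF.
Qed.

Lemma augmentation_idealP x : x \in M -> exists2 p, x = phi p & p.@[fun=> 0] = 0.
Proof.
move=> xM; have /(mem_gen_alg _ AB)[p xp] : x \in E by case/memv_capP: xM.
by exists p => //; apply/eqP; rewrite -mem_augmentation -xp.
Qed.

Lemma ideal_has1 I : is_ideal E I -> 1 \in I -> I = E.
Proof.
case/is_idealP=> IE EI I1; apply/eqP; rewrite eqEsubv; apply/andP; split; apply/subvP=> //.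
by move=> x xE; rewrite -[x]mulr1 EI.
Qed.

Lemma augmentation_is_ideal : is_ideal E M.
Proof.
apply/is_idealP; split=> [x|x y /(mem_gen_alg _ AB)[p ->] /augmentation_idealP[q -> q0]].
  by case/memv_capP.
by rewrite -pair_evalM // mem_augmentation mevalM q0 mulr0.
Qed.

Lemma augmentation_neq : M != E.
Proof.
apply/eqP => ME; have := gen_alg_1 A B; rewrite -ME -(pair_eval1 A B).
by rewrite mem_augmentation meval1 oner_eq0.
Qed.

Lemma augmentation_maximal : is_maximal_ideal E M.
Proof.
split; [exact: augmentation_is_ideal | exact: augmentation_neq |].
move=> I idI MI; have [IM|/subvPn[x xI xM]] := boolP (I <= M)%VS.
  by left; apply/eqP; rewrite eqEsubv IM.
right; apply: ideal_has1 => //; have [IE _] := is_idealP _ idI.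
have /(mem_gen_alg _ AB)[p xp] := IE _ xI.
move: xM; rewrite xp mem_augmentation; set c := p.@[_] => c0.
have : x - phi (p - c%:MP) \in I.
  by rewrite memvB // (subvP MI) // mem_augmentation mevalB mevalC subrr.
rewrite xp -pair_evalB opprB addrC subrK pair_evalC => cI.
by rewrite -[1](scalerK c0) memvZ.
Qed.

(** If a maximal ideal M' did not contain M, then M' + M = E and M' would contain
    1 - z for some nilpotent z, a unit. *)
Lemma augmentation_local : is_local_alg E M.
Proof.
split; [exact: gen_alg_comm | exact: augmentation_maximal |].
move=> M' [idM' neM' maxM']; have [_ _ maxM] := augmentation_maximal.
have [M'E EM'] := is_idealP _ idM'.
have [ME EM] := is_idealP _ augmentation_is_ideal.
have idS : is_ideal E (M' + M)%VS.
  apply/is_idealP; split=> [x /memv_addP[y yM' [z zM ->]]|x _ xE /memv_addP[y yM' [z zM ->]]].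
    by apply: memvD; [apply: M'E | apply: ME].
  by rewrite mulrDr; apply: memv_add; [apply: EM' | apply: EM].
case: (maxM' _ idS (addvSl _ _)) => [SM'|SE].
  have MM' : (M <= M')%VS by rewrite -SM' addvSr.
  by case: (maxM _ idM' MM') => // M'E'; rewrite M'E' eqxx in neM'.
have := gen_alg_1 A B; rewrite -SE => /memv_addP[y yM' [z zM yz]].
have [p zp p0] := augmentation_idealP zM.
have [k zk] := pair_eval_nilpotent p0; rewrite -zp in zk.
case/eqP: neM'; apply: ideal_has1 => //.
have -> : 1 = (\sum_(i < k) z ^+ i) * y.
  have yE : y = 1 - z by rewrite yz addrK.
  have zS : z * (\sum_(i < k) z ^+ i) = (\sum_(i < k) z ^+ i) * z.
    by rewrite mulr_sumr mulr_suml; apply: eq_bigr => i _; rewrite -exprS exprSr.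
  have := subrX1 z k; rewrite zk sub0r => H.
  by rewrite yE mulrBr mulr1 -zS -[X in X - _]mul1r -mulrBl -opprB mulNr -H opprK.
apply: EM' => //; rewrite memv_suml // => i _.
by rewrite zp -pair_evalXn //; apply/mem_gen_alg => //; eexists.
Qed.

End CommonKernel.

Section Cyclic.
Variable e : 'rV[F]_n.+1.
Hypothesis cyc : forall v, exists p, v = e *m phi p.

(** By commutativity, what kills the generator e kills every e q(A, B). *)
Lemma cyclic_faithful p : e *m phi p = 0 -> phi p = 0.
Proof.
move=> ep; apply/row_matrixP => i; rewrite row0 rowE.
have [q ->] := cyc (delta_mx 0 i).
by rewrite -mulmxA mulmxE pair_eval_comm -mulmxE mulmxA ep mul0mx.
Qed.

(** x |-> e x embeds the socle into the common left kernel of A and B, a line by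
    the rank bound; conversely, if e s spans that line then s is in the socle. *)
Lemma cyclic_gorenstein : (n <= \rank (row_mx A B))%N -> gorenstein E.
Proof.
move=> rkAB; have [u [u0 uA uB]] := common_kernel.
exists (augmentation_ideal u); first exact: augmentation_local.
have [s us] := cyc u.
have s0 : phi s != 0 by apply: contra u0 => /eqP s0; rewrite us s0 mulmx0.
have sX0 : phi (s * X0) = 0.
  by apply: cyclic_faithful; rewrite pair_evalM // pair_evalX0 -mulmxE mulmxA -us.
have sX1 : phi (s * X1) = 0.
  by apply: cyclic_faithful; rewrite pair_evalM // pair_evalX1 -mulmxE mulmxA -us.
have memM p : p.@[fun=> 0] = 0 -> phi p \in augmentation_ideal u.
  by move=> p0; rewrite mem_augmentation // p0.
suff -> : socle E (augmentation_ideal u) = <[phi s]>%VS by rewrite dim_vline s0.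
apply/eqP; rewrite eqEsubv; apply/andP; split; last first.
  rewrite -memvE; apply/socleP; split; first by apply/mem_gen_alg => //; exists s.
  move=> y /(augmentation_idealP u0 uA uB)[p -> p0].
  have [q [r pE]] := mpoly2_decomp p; rewrite p0 mpolyC0 add0r in pE.
  rewrite -pair_evalM // pE mulrDr !mulrA pair_evalD !(pair_evalM AB (_ * _)).
  by rewrite sX0 sX1 !mul0r addr0.
apply/subvP => _ /socleP[/(mem_gen_alg _ AB)[p ->] pM].
have pA : phi p * A = 0.
  by rewrite -{2}(pair_evalX0 A B) pM // memM // mevalXU.
have pB : phi p * B = 0.
  by rewrite -{2}(pair_evalX1 A B) pM // memM // mevalXU.
have uK : (u <= kermx (row_mx A B))%MS.
  by apply/sub_kermxP; rewrite mul_mx_row uA uB row_mx0.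
have pK : (e *m phi p <= kermx (row_mx A B))%MS.
  by apply/sub_kermxP; rewrite mul_mx_row -!mulmxA !mulmxE pA pB !mulmx0 row_mx0.
have rkK : (\rank (kermx (row_mx A B)) <= 1)%N.
  by rewrite mxrank_ker leq_subLR addn1.
have : (kermx (row_mx A B) <= u)%MS.
  by rewrite -(geq_leqif (mxrank_leqif_sup uK)) (leq_trans rkK) // lt0n mxrank_eq0.
move/(submx_trans pK)/sub_rVP => [c ec]; apply/vlineP; exists c.
apply/eqP; rewrite -subr_eq0 -pair_evalZ -pair_evalB; apply/eqP/cyclic_faithful.
by rewrite pair_evalB pair_evalZ mulmxBr -scalemxAr -us ec subrr.
Qed.

End Cyclic.
End LocalPair.

(** * Two local generators for the kernel of evaluation *)

(** The determinant trick: if g = D f + C g with C(0) = 0, then multiplying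
    (1 - C) g = D f by the adjugate of 1 - C gives det (1 - C) g in (f), and
    det (1 - C) takes the value 1 at the origin. *)
Lemma local_nakayama (F : fieldType) r s m (f : 'I_s -> {mpoly F[r]})
    (g : 'I_m -> {mpoly F[r]}) :
    (forall i, exists d c, (forall j, (c j).@[fun=> 0] = 0) /\
        g i = \sum_j d j * f j + \sum_j c j * g j) ->
  exists2 u, u.@[fun=> 0] != 0 &
    forall i, exists c, u * g i = \sum_j c j * f j.
Proof.
move=> /fin_all_exists[d /fin_all_exists[c gE]].
pose C := \matrix_(i, j) c i j; pose D := \matrix_(i, j) d i j.
pose gc := \col_i g i; pose fc := \col_j f j.
have CD : (1%:M - C) *m gc = D *m fc.
  rewrite mulmxBl mul1mx; apply/matrixP => i k; rewrite !mxE.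
  have [_ ->] := gE i; apply/eqP; rewrite subr_eq; apply/eqP.
  by congr (_ + _); apply: eq_bigr => j _; rewrite !mxE.
exists (\det (1%:M - C)).
  rewrite -det_map_mx map_mxB map_mx1 (_ : map_mx _ C = 0) ?subr0 ?det1 ?oner_eq0 //.
  by apply/matrixP => i j; rewrite /C !mxE /=; have [-> _] := gE i.
move=> i; exists (fun j => (\adj (1%:M - C) *m D) i j).
have : \det (1%:M - C) *: gc = \adj (1%:M - C) *m D *m fc.
  by rewrite -mulmxA -CD mulmxA mul_adj_mx mul_scalar_mx.
by move/matrixP/(_ i 0); rewrite !mxE => ->; apply: eq_bigr => j _; rewrite !mxE.
Qed.

Section MatrixRank.
Variable F : fieldType.

Lemma rank_unit_sub_rank1 n (P : 'M[F]_n.+1) (z : 'cV_n.+1) (e : 'rV_n.+1) :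
  P + z *m e \in unitmx -> (n <= \rank P)%N.
Proof.
move/mxrank_unit => rk; have : (n.+1 <= \rank P + \rank (z *m e))%N.
  by rewrite -{1}rk mxrank_add.
have rk1 : (\rank (z *m e) <= 1)%N.
  exact: leq_trans (mxrankM_maxr _ _) (rank_leq_row _).
by move/leq_trans=> /(_ _ (leq_add (leqnn _) rk1)); rewrite addn1 ltnS.
Qed.

Lemma monogenic_rank n (A B : 'M[F]_n.+1) :
  monogenic A B -> (n <= \rank (col_mx A B))%N.
Proof.
move=> [X [Y [z [e /rank_unit_sub_rank1 rk]]]]; apply: leq_trans rk _.
by rewrite -mul_row_col mxrankM_maxr.
Qed.

Lemma rank_bounded_generators m n r (M : 'M[F]_(m, n)) :
  (\rank M <= r)%N -> exists Z : 'M_(r, n), (Z :=: M)%MS.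
Proof.
move=> rkM; exists ((pid_mx (\rank M) : 'M_(r, _)) *m row_base M).
apply/eqmxP/andP; split; first by rewrite (submx_trans (submxMl _ _)) ?eq_row_base.
rewrite -(eq_row_base M) -{1}[row_base M]mul1mx -(pid_mx_1 F (\rank M)).
have -> : pid_mx (\rank M) = (pid_mx (\rank M) : 'M[F]_(\rank M, r)) *m
   (pid_mx (\rank M) : 'M[F]_(r, \rank M)).
  by rewrite mul_pid_mx minnn (minn_idPr rkM).
by rewrite -mulmxA submxMl.
Qed.

Lemma complement_generators m1 m2 n r (K : 'M[F]_(m1, n)) (D : 'M[F]_(m2, n)) :
    (D <= K)%MS -> (\rank K <= \rank D + r)%N ->
  exists Z : 'M_(r, n), (Z <= K)%MS /\ (K <= D + Z)%MS.
Proof.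
move=> DK rk; have capE : (K :&: D :=: D)%MS by apply: capmx_idPr; rewrite DK.
have rkD : (\rank (K :\: D) <= r)%N.
  by rewrite -(leq_add2l (\rank (K :&: D)%MS)) mxrank_cap_compl capE.
have [Z ZE] := rank_bounded_generators rkD; exists Z.
rewrite ZE diffmxSl; split=> //.
rewrite -(addsmx_diff_cap_eq K D) addsmx_sub (submx_trans _ (addsmxSr D Z)) ?ZE //.
by rewrite (submx_trans _ (addsmxSl D Z)) // capE.
Qed.

End MatrixRank.

Section CompleteIntersection.
Variables (F : fieldType) (n : nat) (A B : 'M[F]_n.+1).
Hypotheses (AB : A * B = B * A) (nA : nilpotent_mx A) (nB : nilpotent_mx B).
Local Notation phi := (pair_eval A B).
Implicit Types (p q : {mpoly F[2]}) (u v : 'rV[F]_n.+1) (X : 'M[F]_n.+1).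

Lemma pair_eval_lrmorphism :
  exists f : {lrmorphism {mpoly F[2]} -> 'M[F]_n.+1}, f =1 phi.
Proof.
have lin : linear phi by move=> c p q; rewrite pair_evalD pair_evalZ.
have mul : monoid_morphism phi by split; [exact: pair_eval1 | exact: pair_evalM].
pose L := GRing.isLinear.Build F {mpoly F[2]} 'M[F]_n.+1 *:%R phi lin.
pose M := GRing.isMonoidMorphism.Build {mpoly F[2]} 'M[F]_n.+1 phi mul.
pose f : {lrmorphism {mpoly F[2]} -> 'M[F]_n.+1} := HB.pack phi L M.
by exists f.
Qed.

Variable e : 'rV[F]_n.+1.
Hypothesis cyc : forall v, exists p, v = e *m phi p.

Variable S : 'I_n.+1 -> {mpoly F[2]}.
Hypothesis eS : forall i, delta_mx 0 i = e *m phi (S i).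

(** A linear section of p |-> e p(A, B). *)
Definition poly_lift v := \sum_i v 0 i *: S i.

Lemma poly_liftD u v : poly_lift (u + v) = poly_lift u + poly_lift v.
Proof. by rewrite -big_split; apply: eq_bigr => i _; rewrite !mxE scalerDl. Qed.

Lemma poly_liftZ c v : poly_lift (c *: v) = c *: poly_lift v.
Proof. by rewrite scaler_sumr; apply: eq_bigr => i _; rewrite !mxE scalerA. Qed.

Lemma poly_lift_sum (I : finType) (G : I -> 'rV_n.+1) :
  poly_lift (\sum_i G i) = \sum_i poly_lift (G i).
Proof.
apply: (big_morph poly_lift poly_liftD).
by rewrite /poly_lift big1 // => i _; rewrite mxE scale0r.
Qed.

Lemma poly_liftK v : e *m phi (poly_lift v) = v.
Proof.
have phi_sum (I : finType) (G : I -> {mpoly F[2]}) : phi (\sum_i G i) = \sum_i phi (G i).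
  by apply: (big_morph phi (@pair_evalD _ _ A B)); rewrite /pair_eval mmap0.
rewrite phi_sum mulmx_sumr [RHS]row_sum_delta; apply: eq_bigr => i _.
by rewrite pair_evalZ -scalemxAr -eS.
Qed.

Lemma cyclic_eval_eq0 p : e *m phi p = 0 <-> phi p = 0.
Proof. by split=> [|->]; [apply: cyclic_faithful | rewrite mulmx0]. Qed.

(** The relations below rewrite 1 and each product of a variable with a lift into
    a lift, so modulo them every p is congruent to poly_lift (e p(A, B)), which is 0
    when p is in the kernel. *)
Lemma kernel_finitely_generated :
  exists (T : finType) (g : T -> {mpoly F[2]}), (forall t, phi (g t) = 0) /\
    forall p, phi p = 0 -> exists c, p = \sum_t c t * g t.
Proof.
pose g (t : option ('I_n.+1 + 'I_n.+1)) := match t with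
  | None => 1 - poly_lift e
  | Some (inl i) => X0 * S i - poly_lift (delta_mx 0 i *m A)
  | Some (inr i) => X1 * S i - poly_lift (delta_mx 0 i *m B) end.
exists (option ('I_n.+1 + 'I_n.+1) : finType), g; split.
  move=> t; apply/cyclic_eval_eq0; case: t => [[i|i]|]; rewrite /g pair_evalB mulmxBr poly_liftK.
  - by rewrite mulrC pair_evalM // pair_evalX0 -mulmxE mulmxA -eS subrr.
  - by rewrite mulrC pair_evalM // pair_evalX1 -mulmxE mulmxA -eS subrr.
  - by rewrite pair_eval1 mulmx1 subrr.
pose J p := exists c, p = \sum_t c t * g t.
have JD p q : J p -> J q -> J (p + q).
  move=> [c ->] [d ->]; exists (fun t => c t + d t).
  by rewrite -big_split; apply: eq_bigr => t _; rewrite mulrDl.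
have JM p q : J q -> J (p * q).
  move=> [c ->]; exists (fun t => p * c t).
  by rewrite mulr_sumr; apply: eq_bigr => t _; rewrite mulrA.
have Jg t : J (g t).
  exists (fun t' => (t' == t)%:R); rewrite (bigD1 t) //= eqxx mul1r big1 ?addr0 //.
  by move=> t' /negPf->; rewrite mul0r.
have J0 : J 0 by rewrite -(mul0r (g None)); apply: JM.
have Jsum (G : 'I_n.+1 -> {mpoly F[2]}) : (forall i, J (G i)) -> J (\sum_i G i).
  by move=> JG; elim/big_ind: _.
have JZ c p : J p -> J (c *: p) by rewrite -mul_mpolyC; apply: JM.
have JX0 v : J (X0 * poly_lift v - poly_lift (v *m A)).
  have -> : X0 * poly_lift v - poly_lift (v *m A) = \sum_i v 0 i *: g (Some (inl i)).
    rewrite {2}[v]row_sum_delta mulmx_suml poly_lift_sum mulr_sumr -sumrB.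
    by apply: eq_bigr => i _; rewrite /g -scalemxAl poly_liftZ scalerBr scalerAr.
  by apply: Jsum => i; apply: JZ.
have JX1 v : J (X1 * poly_lift v - poly_lift (v *m B)).
  have -> : X1 * poly_lift v - poly_lift (v *m B) = \sum_i v 0 i *: g (Some (inr i)).
    rewrite {2}[v]row_sum_delta mulmx_suml poly_lift_sum mulr_sumr -sumrB.
    by apply: eq_bigr => i _; rewrite /g -scalemxAl poly_liftZ scalerBr scalerAr.
  by apply: Jsum => i; apply: JZ.
have Jlift p : J (p - poly_lift (e *m phi p)).
  elim/mpoly2_ind: p => [|p Jp|p Jp|c p Jp|p q Jp Jq].
  - by rewrite pair_eval1 mulmx1; apply: (Jg None).
  - rewrite {2}mulrC pair_evalM // pair_evalX0 -mulmxE mulmxA.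
    have -> : forall v, X0 * p - poly_lift (v *m A) =
      X0 * (p - poly_lift v) + (X0 * poly_lift v - poly_lift (v *m A)).
      by move=> v; ring.
    by apply: JD => //; apply: JM.
  - rewrite {2}mulrC pair_evalM // pair_evalX1 -mulmxE mulmxA.
    have -> : forall v, X1 * p - poly_lift (v *m B) =
      X1 * (p - poly_lift v) + (X1 * poly_lift v - poly_lift (v *m B)).
      by move=> v; ring.
    by apply: JD => //; apply: JM.
  - by rewrite pair_evalZ -scalemxAr poly_liftZ -scalerBr; apply: JZ.
  - by rewrite pair_evalD mulmxDr poly_liftD opprD addrACA; apply: JD.
move=> p p0; have := Jlift p; rewrite p0 mulmx0.
by rewrite -(scale0r e) poly_liftZ scale0r subr0.
Qed.

Hypotheses (rkcol : (n <= \rank (col_mx A B))%N)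
  (rkkoszul : (n <= \rank (row_mx (- B) A))%N).

(** Koszul homology of F^n for (A, B): K is the space of 1-cycles (a, b), with
    a A + b B = 0, and D the space of boundaries (- c B, c A).  The rank bounds
    give dim K <= dim D + 2, so two cycles Z complete D; their lifts give the
    two polynomials X0 a + X1 b.  For p = X0 al + X1 be in the kernel, the cycle
    of (al, be) is a combination of these two plus a boundary, and changing al
    and be by the Koszul syzygy (X1, - X0) absorbs the boundary. *)
Lemma kernel_two_generators_mod_maximal :
  exists f : 'I_2 -> {mpoly F[2]}, (forall j, phi (f j) = 0) /\
    forall p, phi p = 0 -> exists d q r, [/\ phi q = 0, phi r = 0 &
      p = \sum_j d j *: f j + (X0 * q + X1 * r)].
Proof.
pose K := kermx (col_mx A B); pose D := row_mx (- B) A.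
have DK : (D <= K)%MS.
  by apply/sub_kermxP; rewrite mul_row_col mulNmx !mulmxE AB addNr.
have rkK : (\rank K <= \rank D + 2)%N.
  rewrite mxrank_ker leq_subLR (leq_trans _ (leq_add rkcol (leq_add rkkoszul (leqnn 2)))) //.
  by rewrite addnA addn2 addSn addnS.
have [Z [ZK KDZ]] := complement_generators DK rkK.
pose a j := lsubmx (row j Z); pose b j := rsubmx (row j Z).
have ab j : a j *m A + b j *m B = 0.
  rewrite -mul_row_col hsubmxK; apply/sub_kermxP.
  exact: submx_trans (row_sub _ _) ZK.
pose f j := X0 * poly_lift (a j) + X1 * poly_lift (b j).
have ephi q r : e *m phi (X0 * q + X1 * r) = e *m phi q *m A + e *m phi r *m B.
  rewrite mulrC (mulrC X1) pair_evalD !pair_evalM // pair_evalX0 pair_evalX1.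
  by rewrite mulmxDr -!mulmxE !mulmxA.
exists f; split=> [j|p p0]; first by apply/cyclic_eval_eq0; rewrite ephi !poly_liftK ab.
have [al [be pE]] := mpoly2_decomp p.
have pc0 : p.@[fun=> 0] = 0.
  have [u [u0 uA uB]] := common_kernel AB nA nB.
  have := pair_eval_kernel AB p uA uB; rewrite p0 mulmx0 => /esym/eqP.
  by rewrite scaler_eq0 (negPf u0) orbF => /eqP.
rewrite pc0 mpolyC0 add0r in pE.
have /submx_trans/(_ KDZ) : (row_mx (e *m phi al) (e *m phi be) <= K)%MS.
  by apply/sub_kermxP; rewrite mul_row_col -ephi -pE p0 mulmx0.
case/sub_addsmxP=> -[c d] /=.
rewrite (_ : d *m Z = \sum_j d 0 j *: row j Z); last first.
  by rewrite [LHS]mulmx_sum_row.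
rewrite mul_mx_row => rowE.
have aE : e *m phi al = - (c *m B) + \sum_j d 0 j *: a j.
  rewrite -[LHS](row_mxKl _ (e *m phi be)) rowE linearD /= row_mxKl mulmxN linear_sum.
  by congr (_ + _); apply: eq_bigr => j _; rewrite linearZ.
have bE : e *m phi be = c *m A + \sum_j d 0 j *: b j.
  rewrite -[LHS](row_mxKr (e *m phi al)) rowE linearD /= row_mxKr linear_sum.
  by congr (_ + _); apply: eq_bigr => j _; rewrite linearZ.
exists (d 0), (al - poly_lift (\sum_j d 0 j *: a j) + X1 * poly_lift c),
  (be - poly_lift (\sum_j d 0 j *: b j) - X0 * poly_lift c); split.
- apply/cyclic_eval_eq0; rewrite pair_evalD pair_evalB mulmxDr mulmxBr aE poly_liftK addrK.
  by rewrite mulrC pair_evalM // pair_evalX1 -mulmxE mulmxA poly_liftK addNr.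
- apply/cyclic_eval_eq0; rewrite !pair_evalB !mulmxBr bE poly_liftK addrK.
  by rewrite mulrC pair_evalM // pair_evalX0 -mulmxE mulmxA poly_liftK subrr.
rewrite {1}pE !poly_lift_sum; under [in RHS]eq_bigr do rewrite scalerDr !scalerAr -!poly_liftZ.
rewrite big_split -!mulr_sumr /=; ring.
Qed.

End CompleteIntersection.

(** The kernel I of evaluation is finitely generated and equals (f_0, f_1) + m I,
    so that it is generated by f_0 and f_1 in the local ring at the origin. *)
Lemma gen_alg_complete_intersection (F : fieldType) (n : nat)
    (A B : 'M[F]_n.+1) (e : 'rV_n.+1) :
    A * B = B * A -> nilpotent_mx A -> nilpotent_mx B ->
    (forall v, exists p, v = e *m pair_eval A B p) ->
    (n <= \rank (col_mx A B))%N -> (n <= \rank (row_mx (- B) A))%N ->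
  complete_intersection (gen_alg A B).
Proof.
move=> AB nA nB cyc rkc rkr.
have /fin_all_exists[S eS] : forall i : 'I_n.+1, exists p,
  delta_mx 0 i = e *m pair_eval A B p by [].
have [T [g [g0 ggen]]] := kernel_finitely_generated AB cyc eS.
have [f [f0 fgen]] := kernel_two_generators_mod_maximal AB nA nB cyc eS rkc rkr.
have [phi phiE] := pair_eval_lrmorphism AB.
exists 2, f, phi; split=> [x|p].
  rewrite mem_gen_alg //; split=> -[p xp]; exists p; first by rewrite phiE.
  by rewrite -xp phiE.
rewrite phiE; split=> [p0|[u u0 [c upE]]]; last first.
  apply: (pair_eval_cancel AB nA nB u0); rewrite -pair_evalM // upE.
  rewrite big_ord_recl big_ord1 pair_evalD !pair_evalM //.
  by rewrite !f0 !mulr0 addr0.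
have reindexT (c : T -> {mpoly F[2]}) :
    \sum_t c t * g t = \sum_(i < #|T|) c (enum_val i) * g (enum_val i).
  by rewrite (reindex _ (onW_bij _ (enum_val_bij T))).
have [i|u u0 ug] := @local_nakayama F _ _ _ f (fun i : 'I_#|T| => g (enum_val i)).
  have [d [q [r [q0 r0 gE]]]] := fgen _ (g0 (enum_val i)).
  have [cq qE] := ggen _ q0; have [cr rE] := ggen _ r0.
  exists (fun j => (d j)%:MP), (fun j => X0 * cq (enum_val j) + X1 * cr (enum_val j)).
  split=> [j|]; first by rewrite mevalD !mevalM !mevalXU !mul0r addr0.
  rewrite gE {1}qE {1}rE !reindexT !mulr_sumr -big_split; congr (_ + _).
    by apply: eq_bigr => j _; rewrite mul_mpolyC.
  by apply: eq_bigr => j _ /=; ring.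
exists u => //; have [c pE] := ggen _ p0.
have /fin_all_exists[d dE] := ug.
exists (fun j => \sum_i c (enum_val i) * d i j).
rewrite pE reindexT mulr_sumr.
under [RHS]eq_bigr do rewrite mulr_suml.
rewrite exchange_big; apply: eq_bigr => i _ /=.
rewrite mulrCA dE mulr_sumr; apply: eq_bigr => j _; exact: mulrA.
Qed.

Lemma monogenic_tr_ranks (F : fieldType) (n : nat) (A B : 'M[F]_n.+1) :
  monogenic A^T B^T ->
  (n <= \rank (row_mx A B))%N /\ (n <= \rank (row_mx (- B) A))%N.
Proof.
move=> [X [Y [z [e]]]]; rewrite -unitmx_tr !raddfD /= !trmx_mul !trmxK.
move=> /rank_unit_sub_rank1 rk; split; apply: leq_trans rk _.
  by rewrite -mul_row_col mxrankM_maxl.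
have -> : A *m X^T + B *m Y^T = row_mx (- B) A *m col_mx (- Y^T) X^T.
  by rewrite mul_row_col mulmxN mulNmx opprK addrC.
exact: mxrankM_maxl.
Qed.

Lemma bimonogenic_gorenstein_ci (F : closedFieldType) (n : nat) (A B : 'M[F]_n.+1) :
    nilpotent_mx B -> nilp_commutator B A -> bimonogenic B A ->
  gorenstein (gen_alg A B) /\ complete_intersection (gen_alg A B).
Proof.
move=> nB [nA AB] [gA /monogenic_tr_ranks[rk1 rk2]].
have [e cyc] := monogenic_cyclic AB nA nB gA.
split; first exact: cyclic_gorenstein cyc rk1.
exact: gen_alg_complete_intersection cyc (monogenic_rank gA) rk2.
Qed.

Theorem corollary2p5 (F : closedFieldType) (n : nat) (B : 'M[F]_n.+1)
    (nilB : nilpotent_mx B) :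
  [/\ zariski_dense_in (nilp_commutator B) (proj_cyclic_triples B),
      generic_in (nilp_commutator B)
        (fun A => gorenstein (gen_alg A B) /\
                  complete_intersection (gen_alg A B))
    & generic_in (nilp_commutator B)
        (fun A => has_cyclic_vector (gen_alg A B) /\
                  has_cyclic_vector (gen_alg A^T B^T))].
Proof.
split.
- move=> W [S WS] [A0 /WS[NA0 [p Sp pA0]]].
  have [A [NA pA gA]] := bimonogenic_dense nilB NA0 pA0.
  have [[v cv] [w cw]] := bimonogenic_cyclic nilB NA gA.
  exists A; split; first by apply/WS; split=> //; exists p.
  by exists v, w.
- by apply: bimonogenic_generic => // A; apply: bimonogenic_gorenstein_ci.
- by apply: bimonogenic_generic => // A; apply: bimonogenic_cyclic.
Qed.
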